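(* Let $J\ge 2$ and, for every dimension $d$, let $F_1,\ldots,F_J$ be distributions on $\mathbb{R}^d$ satisfying assumptions (A1$^\circ$)–(A3$^\circ$) in the context. For each $j$ let $\mathbf{X}_{j1},\ldots,\mathbf{X}_{jn_j}$ be a training sample from $F_j$ with fixed $n_j\ge 2$, all training observations mutually independent and independent of the test observation. If $\mathcal{E}_{ji}>0$ for all $j\neq i$, then the misclassification rate of the MDist1 classifier converges to $0$ as $d\to\infty$.
   Context: $\|\mathbf{v}\|_1=\sum_q|v_q|$; ''measurement variables'' are coordinates. Assumptions: (A1$^\circ$) In each class, the coordinates have second moments bounded uniformly over coordinates and $d$. (A2$^\circ$) If $\mathbf{X}=(X_1,\ldots,X_d)^\top\sim F_j$ and $\mathbf{Y}=(Y_1,\ldots,Y_d)^\top\sim F_i$ ($1\le j,i\le J$) are independent and $\mathbf{U}=\mathbf{X}-\mathbf{Y}$, then $\sum_{r\neq s}|\mathrm{Corr}(|U_r|,|U_s|)|=o(d^2)$. (A3$^\circ$) For independent $\mathbf{X}\sim F_j$, $\mathbf{Y}\sim F_i$ ($1\le j,i\le J$), $\frac1d E\|\mathbf{X}-\mathbf{Y}\|_1=\frac1d\sum_{q=1}^dE|X_q-Y_q|$ converges to a constant $\tau_{ji}$ as $d\to\infty$. For $j\ne i$ and independent $\mathbf{X},\mathbf{X}'\sim F_j$, $\mathbf{Y},\mathbf{Y}'\sim F_i$, let $e_{ji}^{(q)}=2E|X_q-Y_q|-E|X_q-X_q'|-E|Y_q-Y_q'|$, $\bar e_{ji}(d)=\frac1d\sum_{q=1}^d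 e_{ji}^{(q)}$, and $\mathcal{E}_{ji}=\lim_{d\to\infty}\bar e_{ji}(d)$. MDist1 classifier: for a point $\mathbf{z}$, its feature vector is $(d^*_1(\mathbf{z}),\ldots,d^*_J(\mathbf{z}))$ with $d^*_j(\mathbf{z})=\min_{1\le\ell\le n_j}\|\mathbf{z}-\mathbf{X}_{j\ell}\|_1$; for a training point $\mathbf{X}_{ji}$ the features are computed leave-one-out (the minimum over its own class excludes $\ell=i$). A test observation is assigned to the class of the training observation whose feature vector is nearest (Euclidean distance) to its own feature vector. Misclassification rate converging to $0$ means that for each $j$, the probability that $\mathbf{Z}\sim F_j$ is not assigned to class $j$ tends to $0$. *)

(* Defs.v *)
From HB Require Import structures.
From mathcomp Require Import all_boot all_order all_algebra.
From mathcomp Require Import all_classical all_reals all_analysis.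
Set Implicit Arguments.
Unset Strict Implicit.
Unset Printing Implicit Defensive.
Import Order.TTheory GRing.Theory Num.Theory.
Local Open Scope classical_set_scope.
Local Open Scope ring_scope.

Section Moments.
Context {R : realType} {dT : measure_display} {T : measurableType dT}.
Variable P : probability T R.

(* expectation of a real function (real-valued; finite under the assumptions) *)
Definition Ex (f : T -> R) : R := fine (\int[P]_w (f w)%:E).
Definition Cov (f g : T -> R) : R := Ex (fun w => f w * g w) - Ex f * Ex g.
(* correlation; convention: 0 when a variance vanishes (x / 0 = 0) *)
Definition Corr (f g : T -> R) : R := Cov f g / Num.sqrt (Cov f f * Cov g g).

(* two random vectors on the same space have the same law (on R^d):
   they agree on all measurable boxes (a pi-system generating Borel(R^d)) *)
Definition same_law (d : nat) (U V : 'I_d -> T -> R) : Prop :=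
  forall B : 'I_d -> set R, (forall q, measurable (B q)) ->
    P [set w | forall q, B q (U q w)] = P [set w | forall q, B q (V q w)].

Definition indep_vecs (I : finType) (d : nat) (V : I -> 'I_d -> T -> R) : Prop :=
  forall B : I -> 'I_d -> set R, (forall i q, measurable (B i q)) ->
    fine (P [set w | forall i q, B i q (V i q w)]) =
    \prod_(i : I) fine (P [set w | forall q, B i q (V i q w)]).
End Moments.

Section Classifier.
Context {R : realType}.
Variables (J : nat) (n : 'I_J -> nat).

Definition tidx := {j : 'I_J & 'I_(n j)}.

Definition l1dist (d : nat) (x y : 'I_d -> R) : R := \sum_(q < d) `|x q - y q|.

Definition eucl (a b : 'I_J -> R) : R := Num.sqrt (\sum_(k < J) (a k - b k) ^+ 2).

Variable d : nat.
Variable x : tidx -> 'I_d -> R.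

Definition minl1 (excl : pred tidx) (z : 'I_d -> R) (k : 'I_J) : R :=
  fine (\big[Order.min/+oo%E]_(p : tidx | (tag p == k) && ~~ excl p)
          (l1dist z (x p))%:E).

Definition feat_test (z : 'I_d -> R) : 'I_J -> R := minl1 pred0 z.

Definition feat_train (p : tidx) : 'I_J -> R := minl1 (pred1 p) (x p).

(* MDist1 fails to assign z to class j: some training point of another class
   is at least as near (in feature space) as every class-j training point
   (ties are counted as errors) *)
Definition MDist1_misclassifies (z : 'I_d -> R) (j : 'I_J) : Prop :=
  exists p : tidx, tag p != j /\
    forall p' : tidx, tag p' = j ->
      eucl (feat_test z) (feat_train p) <= eucl (feat_test z) (feat_train p').
End Classifier.

(* Main.v *)
Require Import Defs.
From HB Require Import structures.
From mathcomp Require Import all_boot all_order all_algebra.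
From mathcomp Require Import all_classical all_reals all_analysis.
From mathcomp Require Import measurable_realfun ring lra.
Import Order.TTheory GRing.Theory Num.Theory.
Import numFieldNormedType.Exports.
Set Implicit Arguments.
Unset Strict Implicit.
Unset Printing Implicit Defensive.
Local Open Scope classical_set_scope.
Local Open Scope ring_scope.

(** By (A1) and (A2) the variance of the scaled l1-distance between two distinct
    training points tends to 0, so by Chebyshev and (A3) this distance converges
    in probability to a constant [t j i] depending only on the two classes; the
    same holds with the test point, because a distance between two independent
    points has a law determined by the two marginal laws, and every class has at
    least two training points.  Hence the scaled features of a point of class
    [j] converge in probability to the row [t j].  The limit of the energy is
    [2 t j i - t j j - t i i]; it is positive, so the rows [t j] and [t i]
    differ, and the nearest feature vector eventually belongs to the right
    class. *)

(** * Covariance in L2, Cauchy-Schwarz and correlations *)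

Section Covariance.
Context {R : realType} {dT : measure_display} {T : measurableType dT}.
Context (P : probability T R).
Implicit Types f g : T -> R.

Lemma Lfun2_of_sqr f (C : R) : measurable_fun setT f ->
  (\int[P]_w ((f w) ^+ 2)%:E <= C%:E)%E -> f \in Lfun P 2%:E.
Proof.
move=> mf fC; rewrite inE; apply/andP; split; rewrite inE//=.
rewrite /finite_norm unlock /Lnorm poweR_lty//.
apply: (le_lt_trans _ (ltry C)); apply: le_trans fC.
by under eq_integral do rewrite /= powR_mulrn// real_normK ?num_real//.
Qed.

Lemma Lfun2_1 f : f \in Lfun P 2%:E -> f \in Lfun P 1.
Proof.
by move=> f2; apply: Lfun_subset12 f2; exact: (fin_num_measure P _ measurableT).
Qed.

Lemma Ex_expectation f : f \in Lfun P 1 -> (Ex P f)%:E = expectation P f.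
Proof. by move=> /expectation_fin_num; rewrite unlock => /fineK. Qed.

(** On L2 every integral involved is finite, so [fine] loses nothing and facts about the
    extended-real [covariance] transfer to [Cov]. *)
Lemma Cov_covariance f g : f \in Lfun P 2%:E -> g \in Lfun P 2%:E ->
  (Cov P f g)%:E = covariance P f g.
Proof.
move=> f2 g2; have fg := Lfun2_mul_Lfun1 f2 g2.
have [f1 g1] := (Lfun2_1 f2, Lfun2_1 g2).
by rewrite covarianceE// /Cov EFinB EFinM !Ex_expectation.
Qed.

Lemma CovC f g : Cov P f g = Cov P g f.
Proof.
by rewrite /Cov mulrC; congr (Ex P _ - _); apply/funext => w; rewrite mulrC.
Qed.

Lemma CovDl f g h : f \in Lfun P 2%:E -> g \in Lfun P 2%:E ->
  h \in Lfun P 2%:E -> Cov P (f + g) h = Cov P f h + Cov P g h.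
Proof.
move=> f2 g2 h2; apply: EFin_inj.
by rewrite [RHS]EFinD !Cov_covariance ?rpredD ?lee1n// covarianceDl.
Qed.

Lemma Cov_suml (I : Type) (s : seq I) (F : I -> T -> R) h :
  (forall i, F i \in Lfun P 2%:E) -> h \in Lfun P 2%:E ->
  Cov P (\sum_(i <- s) F i) h = \sum_(i <- s) Cov P (F i) h.
Proof.
move=> F2 h2; elim: s => [|i s IH]; last first.
  by rewrite !big_cons CovDl ?IH// rpred_sum ?lee1n.
rewrite !big_nil; apply: EFin_inj.
rewrite Cov_covariance ?Lfun_cst// -[0 : T -> R]/(cst 0).
by rewrite covariance_cst_l.
Qed.

Lemma Cov_ge0 f : f \in Lfun P 2%:E -> 0 <= Cov P f f.
Proof. by move=> f2; rewrite -lee_fin Cov_covariance// variance_ge0. Qed.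

(** Cauchy-Schwarz. The one-sided bound [covariance_le], applied to [f] and to [- f], bounds the
    absolute value of the covariance; squaring removes the roots. *)
Lemma Cov_sqr_le f g : f \in Lfun P 2%:E -> g \in Lfun P 2%:E ->
  Cov P f g ^+ 2 <= Cov P f f * Cov P g g.
Proof.
move=> f2 g2; set a := Cov P f f; set b := Cov P g g.
have le1 h : h \in Lfun P 2%:E -> Cov P h g <= Num.sqrt (Cov P h h) * Num.sqrt b.
  move=> h2; have := covariance_le h2 g2.
  by rewrite /variance -!Cov_covariance//= lee_fin.
have a0 : 0 <= a by exact: Cov_ge0.
have b0 : 0 <= b by exact: Cov_ge0.
have Nf2 : - f \in Lfun P 2%:E by rewrite rpredN ?lee1n.
have NE h : h \in Lfun P 2%:E -> Cov P (- f) h = - Cov P f h.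
  move=> h2; apply: EFin_inj.
  rewrite [RHS]EFinN !Cov_covariance// covarianceNl//; first exact: Lfun2_1.
    exact: Lfun2_1.
  exact: Lfun2_mul_Lfun1.
have := le1 _ Nf2; rewrite (NE _ g2) NE// (CovC f (- f)) NE// opprK => h1.
rewrite -real_normK ?num_real// -(sqr_sqrtr (mulr_ge0 a0 b0)) sqrtrM//.
by rewrite ler_sqr ?nnegrE// ?mulr_ge0 ?sqrtr_ge0// ler_norml lerNl h1 le1.
Qed.

(** If a variance vanishes, [Corr] is 0 by convention, but Cauchy-Schwarz makes the covariance 0
    too. Otherwise the denominator of [Corr] is positive and at most [V]. *)
Lemma Cov_le_Corr f g (V : R) : f \in Lfun P 2%:E -> g \in Lfun P 2%:E ->
  Cov P f f <= V -> Cov P g g <= V -> `|Cov P f g| <= V * `|Corr P f g|.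
Proof.
move=> f2 g2 fV gV.
have f0 := Cov_ge0 f2; have g0 := Cov_ge0 g2.
have := Cov_sqr_le f2 g2; rewrite /Corr.
have [->|ab0] := eqVneq (Cov P f f * Cov P g g) 0.
  rewrite real_exprn_even_le0 ?num_real//= => /eqP ->.
  by rewrite mul0r normr0 mulr0.
move=> _; set s := Num.sqrt _.
have s0 : 0 < s by rewrite sqrtr_gt0 lt_neqAle eq_sym ab0 mulr_ge0.
rewrite normrM normfV (gtr0_norm s0) mulrCA ler_peMr// ler_pdivlMr// mul1r.
have V0 : 0 <= V := le_trans f0 fV.
rewrite -(ger0_norm V0) -sqrtr_sqr ler_wsqrtr// expr2.
by rewrite ler_pM.
Qed.

Lemma Cov_le_sqr f (C : R) : f \in Lfun P 2%:E ->
  (\int[P]_w ((f w) ^+ 2)%:E <= C%:E)%E -> Cov P f f <= C.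
Proof.
move=> f2 fC; rewrite -lee_fin Cov_covariance// -/(variance P f) varianceE//.
rewrite -(fineK (expectation_fin_num (Lfun2_1 f2))) -EFin_expe.
apply: (@le_trans _ _ (expectation P (f ^+ 2))).
  by rewrite leeBlDr// leeDl// lee_fin sqr_ge0.
by rewrite unlock.
Qed.

End Covariance.

(** * Weak law of large numbers under small total correlation *)

Section Average.
Context {R : realType} {dT : measure_display} {T : measurableType dT}.
Context (P : probability T R).

Lemma Lfun2_sum (d : nat) (F : 'I_d -> T -> R) :
  (forall q, F q \in Lfun P 2%:E) -> \sum_(q < d) F q \in Lfun P 2%:E.
Proof. by move=> F2; rewrite rpred_sum ?lee1n. Qed.

(** Expanding by bilinearity, each of the [d] diagonal terms is at most [V], and each off-diagonal
    term at most [V] times an absolute correlation, which is the quantity controlled by (A2). *)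
Lemma Cov_sum_le (d : nat) (F : 'I_d -> T -> R) (V : R) :
  (forall q, F q \in Lfun P 2%:E) -> (forall q, Cov P (F q) (F q) <= V) ->
  Cov P (\sum_(q < d) F q) (\sum_(q < d) F q) <=
  V * (d%:R + \sum_(r < d) \sum_(s < d | s != r) `|Corr P (F r) (F s)|).
Proof.
move=> F2 FV; have S2 : \sum_(q < d) F q \in Lfun P 2%:E.
  exact: Lfun2_sum.
rewrite Cov_suml//.
under eq_bigr do rewrite CovC Cov_suml//.
have -> : d%:R = \sum_(r < d) (1 : R) by rewrite sumr_const card_ord.
rewrite -big_split/= mulr_sumr; apply: ler_sum => r _.
rewrite (bigD1 r)//= mulrDr mulr1 lerD// mulr_sumr ler_sum// => s _.
by rewrite (le_trans (ler_norm _))// CovC Cov_le_Corr.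
Qed.

Lemma Ex_sum (d : nat) (F : 'I_d -> T -> R) :
  (forall q, F q \in Lfun P 2%:E) ->
  Ex P (\sum_(q < d) F q) = \sum_(q < d) Ex P (F q).
Proof.
move=> F2.
have F1 q : F q \in Lfun P 1 by exact: Lfun2_1.
apply: EFin_inj; rewrite Ex_expectation ?rpred_sum// -sumEFin.
under [RHS]eq_bigr do rewrite Ex_expectation//.
have := expectation_sum (P := P) (X := [seq F q | q <- index_enum 'I_d]).
by rewrite !big_map; apply => _ /mapP[q _ ->].
Qed.

Lemma chebyshev_Cov (f : T -> R) (e : R) : f \in Lfun P 2%:E -> 0 < e ->
  (P [set w | (e <= `|f w - Ex P f|)%R] <= (e ^- 2 * Cov P f f)%:E)%E.
Proof.
move=> f2 e0; rewrite EFinM Cov_covariance//.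
have mf : f \in mfun by move: f2; rewrite inE => /andP[].
have := chebyshev (P := P) (mfun_Sub mf) e0.
by rewrite mfun_valP /Ex; under eq_set do rewrite expectation.unlock.
Qed.

End Average.

(** The tolerance [e] is split in two: the mean of the average is eventually within [e / 2] of
    [tau], and Chebyshev bounds the probability that the average is [e / 2] or more away from its
    mean. *)
Lemma average_cvg_in_probability (R : realType) (dT : measure_display)
  (Omega : nat -> measurableType dT) (P : forall d, probability (Omega d) R)
  (F : forall d, 'I_d -> Omega d -> R) (V tau : R) :
  (forall d q, F d q \in Lfun (P d) 2%:E) ->
  (forall d q, Cov (P d) (F d q) (F d q) <= V) ->
  (fun d => (d%:R ^+ 2)^-1 *
     \sum_(r < d) \sum_(s < d | s != r) `|Corr (P d) (F d r) (F d s)|)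
    @ \oo --> 0 ->
  (fun d => d%:R^-1 * \sum_(q < d) Ex (P d) (F d q)) @ \oo --> tau ->
  forall e : R, 0 < e ->
  (fun d => P d [set w | e <= `|d%:R^-1 * \sum_(q < d) F d q w - tau|])
    @ \oo --> 0%E.
Proof.
move=> F2 FV cC cM e e0.
pose S d := \sum_(q < d) F d q.
pose K d := \sum_(r < d) \sum_(s < d | s != r) `|Corr (P d) (F d r) (F d s)|.
have S2 d : S d \in Lfun (P d) 2%:E by exact: Lfun2_sum.
(* The variance bound of [Cov_sum_le] divided by the squared Chebyshev threshold [d * (e / 2)] of
   the unscaled sum. *)
pose u d := (e / 2) ^- 2 * V * (d%:R^-1 + (d%:R ^+ 2)^-1 * K d) : R.
have u0 : u @ \oo --> 0.
  rewrite [X in _ --> X](_ : 0 = (e / 2) ^- 2 * V * (0 + 0)); last by ring.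
  apply: cvgM; first exact: cvg_cst.
  apply: cvgD => //; apply/gtr0_cvgV0; last exact: cvgr_idn.
  by near=> d; rewrite ltr0n; near: d; exact: nbhs_infty_gt.
have SE d w : S d w = \sum_(q < d) F d q w by rewrite /S fct_sumE.
have mS d : measurable_fun setT (S d).
  by have := S2 d; rewrite inE => /andP[]; rewrite inE.
apply: (@squeeze_cvge _ _ _ _ (cst 0%E) _ (EFin \o u)).
- near=> d; rewrite measure_ge0/=.
  have d0 : 0 < d%:R :> R.
    by rewrite ltr0n; near: d; exact: nbhs_infty_gt.
  have Md : `|d%:R^-1 * Ex (P d) (S d) - tau| < e / 2.
    by rewrite Ex_sum//; near: d; apply: cvgr_distC_lt => //; lra.
  have de0 : 0 < d%:R * (e / 2) by rewrite mulr_gt0//; lra.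
  (* A deviation of at least [e] from [tau] forces one of at least [e / 2] from the mean, by the
     triangle inequality and [Md]. *)
  apply: (@le_trans _ _
      (P d [set w | (d%:R * (e / 2) <= `|S d w - Ex (P d) (S d)|)%R])).
    have mle (f g : Omega d -> R) : measurable_fun setT f ->
        measurable_fun setT g -> measurable [set w | f w <= g w].
      by move=> mf mg; rewrite -[X in measurable X]setTI; exact: measurable_fun_le.
    apply: le_measure; rewrite ?inE.
    + apply: mle => //; apply: measurableT_comp => //.
      apply: measurable_funB => //; apply: measurable_funM => //.
      rewrite [X in measurable_fun _ X](_ : _ = S d)//.
      by apply/funext => w; rewrite SE.
    + apply: mle => //; apply: measurableT_comp => //.
      exact: measurable_funB.
    + move=> w /=; rewrite -SE => h.
      have -> : S d w - Ex (P d) (S d) =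
        d%:R * (d%:R^-1 * S d w - d%:R^-1 * Ex (P d) (S d)).
        by rewrite -mulrBr mulrA divff ?mul1r// gt_eqF.
      rewrite normrM gtr0_norm// ler_pM2l//.
      set a := d%:R^-1 * S d w in h *; set b := d%:R^-1 * Ex (P d) (S d) in Md *.
      have := ler_distD b a tau; lra.
  apply: le_trans (chebyshev_Cov (S2 d) de0) _.
  rewrite lee_fin.
  have Vle := Cov_sum_le (F2 d) (FV d).
  have -> : u d = (d%:R * (e / 2)) ^- 2 * (V * (d%:R + K d)).
    by rewrite /u; field; rewrite !gt_eqF.
  by rewrite ler_pM2l// invr_gt0 exprn_gt0.
- exact: cvg_cst.
- apply: cvg_EFin => //; exact: nearW.
Unshelve. all: by end_near.
Qed.

(** * The law of the distance between two independent vectors *)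

Section Law.
Context {R : realType} {dT : measure_display} {T : measurableType dT}.
Context (P : probability T R).

Lemma measurable_fin_forall (I : finType) (A : I -> set T) :
  (forall i, measurable (A i)) -> measurable [set w | forall i, A i w].
Proof.
move=> mA; rewrite (_ : [set w | _] = \bigcap_i A i).
  by apply: fin_bigcap_measurable => //; exact: finite_finset.
by apply/seteqP; split => w /= h i; [move=> _|]; exact: h.
Qed.

(** The pi-system on which [same_law] and [indep_vecs] are stated; the sigma-algebra it generates
    serves as the product sigma-algebra on [I -> R]. *)
Definition boxes (I : finType) : set (set (I -> R)) :=
  [set A | exists2 B : I -> set R, (forall i, measurable (B i)) &
           A = [set x | forall i, B i (x i)]].
Arguments boxes : clear implicits.

Lemma boxes_setI (I : finType) : setI_closed (boxes I).
Proof.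
move=> _ _ [B mB ->] [C mC ->]; exists (fun i => B i `&` C i).
  by move=> i; exact: measurableI.
apply/seteqP; split => x /=; first by move=> [h k] i; split.
by move=> h; split => i; case: (h i).
Qed.

Local Notation sigma_boxes I := (g_sigma_algebraType (boxes I)).

Lemma measurable_coord (I : finType) (i : I) :
  measurable_fun setT (fun x : sigma_boxes I => x i : R).
Proof.
move=> _ Y mY; rewrite setTI; apply: sub_sigma_algebra.
exists (fun k => if k == i then Y else setT).
  by move=> k; case: ifP.
apply/seteqP; split => x /= h; first by move=> k; case: eqP => // ->.
by have := h i; rewrite eqxx.
Qed.

Lemma measurable_to_boxes (I : finType) (f : I -> T -> R) :
  (forall i, measurable_fun setT (f i)) ->
  measurable_fun setT (fun w => (fun i => f i w) : sigma_boxes I).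
Proof.
move=> mf; apply: (@measurability _ _ T (sigma_boxes I) _ _ (boxes I)) => //
  _ [_ [B mB ->] <-].
rewrite setTI; apply: measurable_fin_forall => i.
by rewrite -[X in measurable X]setTI; exact: mf.
Qed.

(** Both sides are push-forward measures of [A]. They agree on the boxes, which are closed under
    intersection and include the whole space, so uniqueness of measures applies. *)
Lemma eq_on_boxes (I : finType) (f g : I -> T -> R) :
  (forall i, measurable_fun setT (f i)) ->
  (forall i, measurable_fun setT (g i)) ->
  (forall B : I -> set R, (forall i, measurable (B i)) ->
    P [set w | forall i, B i (f i w)] = P [set w | forall i, B i (g i w)]) ->
  forall A : set (sigma_boxes I), measurable A ->
    P [set w | A (fun i => f i w)] = P [set w | A (fun i => g i w)].
Proof.
move=> mf mg fg A mA.
have mf' := measurable_to_boxes mf; have mg' := measurable_to_boxes mg.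
pose F := mfun_Sub (mem_set mf' : _ \in mfun).
pose G := mfun_Sub (mem_set mg' : _ \in mfun).
have := @measure_unique _ R (sigma_boxes I) (boxes I) (fun=> setT) erefl
  (@boxes_setI I) _ _ (pushforward P F) (pushforward P G) _ _ A mA.
apply => //.
- by move=> _; exists (fun=> setT) => //; apply/seteqP; split.
- by apply/seteqP; split => // x _; exists 0%N.
- by move=> _ [B mB ->]; exact: fg.
- by move=> _; rewrite /= /pushforward preimage_setT probability_setT ltry.
Qed.

(** Taking the whole line as the constraint on every other index, independence factorizes the joint
    probability of a pair into its two marginals, which the equal laws identify. *)
Lemma indep_pair_law (I : finType) (d : nat) (V : I -> 'I_d -> T -> R)
    (a b a' b' : I) : a != b -> a' != b' ->
  (forall i q, measurable_fun setT (V i q)) ->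
  indep_vecs P V -> same_law P (V a) (V a') -> same_law P (V b) (V b') ->
  forall B C : 'I_d -> set R,
  (forall q, measurable (B q)) -> (forall q, measurable (C q)) ->
  P [set w | forall q, B q (V a q w) /\ C q (V b q w)] =
  P [set w | forall q, B q (V a' q w) /\ C q (V b' q w)].
Proof.
move=> ab ab' mV indV la lb B C mB mC.
have prodE k l : k != l ->
    fine (P [set w | forall q, B q (V k q w) /\ C q (V l q w)]) =
    fine (P [set w | forall q, B q (V k q w)]) *
    fine (P [set w | forall q, C q (V l q w)]).
  move=> kl; pose D i q := if i == k then B q else if i == l then C q else setT.
  have lk : (l == k) = false by rewrite eq_sym (negPf kl).
  have mD i q : measurable (D i q) by rewrite /D; case: ifP => // _; case: ifP.
  have := indV D mD.
  rewrite (bigD1 k)//= (bigD1 l) 1?eq_sym//= big1 ?mulr1; last first.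
    move=> i /andP[ik il]; rewrite /D (negPf ik) (negPf il).
    rewrite (_ : [set w | _] = setT) ?probability_setT//.
    by apply/seteqP; split.
  rewrite {2 3}/D !eqxx lk => <-; congr (fine (P _)).
  apply/seteqP; split => w /= h => [i q|q].
    by rewrite /D; case: eqP => [->|_]; [|case: eqP => [->|_//]]; case: (h q).
  by have := (h k q, h l q); rewrite /D !eqxx lk => -[].
have fin A : measurable A -> P A \is a fin_num by move=> ?; exact: fin_num_measure.
have mbox k l : measurable [set w | forall q, B q (V k q w) /\ C q (V l q w)].
  apply: measurable_fin_forall => q.
  apply: (@measurableI _ _ [set w | B q (V k q w)] [set w | C q (V l q w)]);
    rewrite -[X in measurable X]setTI; exact: mV.
rewrite -[LHS]fineK ?fin// -[RHS]fineK ?fin// !prodE//.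
by rewrite (la B mB) (lb C mC).
Qed.

(** This carries convergence known for one pair of training points over to every pair from the same
    classes, including pairs with the test point. *)
Lemma indep_l1dist_law (I : finType) (d : nat) (V : I -> 'I_d -> T -> R)
    (a b a' b' : I) : a != b -> a' != b' ->
  (forall i q, measurable_fun setT (V i q)) ->
  indep_vecs P V -> same_law P (V a) (V a') -> same_law P (V b) (V b') ->
  forall A : set R, measurable A ->
  P [set w | A (l1dist (fun q => V a q w) (fun q => V b q w))] =
  P [set w | A (l1dist (fun q => V a' q w) (fun q => V b' q w))].
Proof.
move=> ab ab' mV indV la lb A mA.
(* The two vectors are concatenated into one family over ['I_d + 'I_d], so that the distance is a
   measurable function of a single vector. *)
pose pair k l (i : 'I_d + 'I_d) := match i with inl q => V k q | inr q => V l q end.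
have mpair k l i : measurable_fun setT (pair k l i) by case: i => q; exact: mV.
have splitE k l (B : 'I_d + 'I_d -> set R) :
    [set w | forall i, B i (pair k l i w)] =
    [set w | forall q, B (inl q) (V k q w) /\ B (inr q) (V l q w)].
  apply/seteqP; split => w /= h; first by move=> q; split; exact: h.
  by move=> [] q; case: (h q).
have := @eq_on_boxes _ (pair a b) (pair a' b') (mpair _ _) (mpair _ _) _
  [set x | A (l1dist (fun q => x (inl q)) (fun q => x (inr q)))].
apply.
- by move=> B mB; rewrite !splitE;
  apply: (@indep_pair_law _ _ _ _ _ _ _ ab ab' mV indV la lb
    (fun q => B (inl q)) (fun q => B (inr q))) => // q; exact: mB.
- have : measurable_fun setT (fun x : sigma_boxes ('I_d + 'I_d)%type =>
      l1dist (fun q => x (inl q)) (fun q => x (inr q))).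
    apply: measurable_sum => q; apply: measurableT_comp => //.
    by apply: measurable_funB; exact: measurable_coord.
  by move=> /(_ measurableT A mA); rewrite setTI.
Qed.

End Law.

(** * Second moments of differences, and a union bound *)

Section Moment.
Context {R : realType} {dT : measure_display} {T : measurableType dT}.
Context (P : probability T R).

(** Pointwise, the square of [f - g] is at most twice the sum of the squares, since the square of
    [f + g] is nonnegative. *)
Lemma integral_sqr_dist_le (f g : T -> R) (C D : R) :
  measurable_fun setT f -> measurable_fun setT g ->
  (\int[P]_w ((f w) ^+ 2)%:E <= C%:E)%E ->
  (\int[P]_w ((g w) ^+ 2)%:E <= D%:E)%E ->
  (\int[P]_w (`|f w - g w| ^+ 2)%:E <= (2 * C + 2 * D)%:E)%E.
Proof.
move=> mf mg fC gD.
have msq (h : T -> R) : measurable_fun setT h ->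
    measurable_fun setT (fun w => (h w ^+ 2)%:E).
  by move=> mh; apply/measurable_EFinP; exact: measurable_funX.
have m2sq (h : T -> R) : measurable_fun setT h ->
    measurable_fun setT (fun w => (2%:E * (h w ^+ 2)%:E)%E).
  by move=> mh; apply: measurable_funeM (msq h mh).
apply: (@le_trans _ _
    (\int[P]_w (2%:E * (f w ^+ 2)%:E + 2%:E * (g w ^+ 2)%:E))%E).
  apply: ge0_le_integral => //.
  - apply: (msq (fun w => `|f w - g w|)).
    by apply: measurableT_comp => //; exact: measurable_funB.
  - by apply: emeasurable_funD; exact: m2sq.
  - move=> w _; rewrite -!EFinM -EFinD lee_fin real_normK ?num_real//.
    have := sqr_ge0 (f w + g w); nra.
have sq0 (h : T -> R) w : (0 <= (h w ^+ 2)%:E)%E by rewrite lee_fin sqr_ge0.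
rewrite ge0_integralD//; last 4 first.
- by move=> w _; rewrite mule_ge0.
- exact: m2sq.
- by move=> w _; rewrite mule_ge0.
- exact: m2sq.
rewrite !ge0_integralZl//; [|exact: msq|exact: msq].
by rewrite (EFinD (2 * C)) !EFinM leeD// lee_pmul2l.
Qed.

End Moment.

Lemma finite_union_cvg0 (R : realType) (dT : measure_display)
  (Omega : nat -> measurableType dT) (P : forall d, probability (Omega d) R)
  (I : Type) (s : seq I) (Q : pred I) (A : I -> forall d, set (Omega d)) :
  (forall i d, measurable (A i d)) ->
  (forall i, Q i -> (fun d => P d (A i d)) @ \oo --> 0%E) ->
  (fun d => P d (\big[setU/set0]_(i <- s | Q i) A i d)) @ \oo --> 0%E.
Proof.
move=> mA cA; elim: s => [|i s IH].
  under eq_fun do rewrite big_nil measure0.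
  exact: cvg_cst.
have [Qi|/negPf Qi] := boolP (Q i); last by under eq_fun do rewrite big_cons Qi.
under eq_fun do rewrite big_cons Qi.
apply: (@squeeze_cvge _ _ _ _ (cst 0%E) _
  (fun d => (P d (A i d) + P d (\big[setU/set0]_(i <- s | Q i) A i d))%E)).
- apply: nearW => d; rewrite measure_ge0/= measureU2//.
    exact: mA.
  by apply: bigsetU_measurable => k _; exact: mA.
- exact: cvg_cst.
- by rewrite -[X in _ --> X]adde0; apply: cvgeD => //; exact: cA.
Qed.

(** * Deterministic part: distances near their limits give the right class *)

Section Features.
Context {R : realType} {J : nat} {n : 'I_J -> nat}.

(** The existence of an admissible point keeps the minimum below its default [+oo], so that [fine]
    returns the true minimum. *)
Lemma minl1_near (d : nat) (x : tidx n -> 'I_d -> R) (excl : pred (tidx n))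
    (z : 'I_d -> R) (k : 'I_J) (c e : R) :
  (exists2 p, tag p = k & ~~ excl p) ->
  (forall p, tag p = k -> ~~ excl p -> `|l1dist z (x p) - c| < e) ->
  `|minl1 x excl z k - c| < e.
Proof.
move=> [p pk Np] near_c; rewrite /minl1; set m := (X in fine X).
have lo : ((c - e)%:E < m)%E.
  apply/bigmin_gtP; split; first exact: ltry.
  move=> q /andP[/eqP qk Nq]; rewrite lte_fin.
  by have := near_c q qk Nq; rewrite ltr_distl => /andP[].
have hi : (m < (c + e)%:E)%E.
  apply: le_lt_trans (_ : (l1dist z (x p))%:E < _)%E.
    by apply: bigmin_le_cond; rewrite pk eqxx.
  by rewrite lte_fin; have := near_c p pk Np; rewrite ltr_distl => /andP[].
have fm : m \is a fin_num.
  by rewrite fin_numElt (lt_trans _ lo) ?ltNyr// (lt_trans hi) ?ltry.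
by move: lo hi; rewrite -(fineK fm) !lte_fin ltr_distl => -> ->.
Qed.

Lemma eucl_le_sum (a b c : 'I_J -> R) :
  (eucl a b <= eucl a c) =
  (\sum_(k < J) (a k - b k) ^+ 2 <= \sum_(k < J) (a k - c k) ^+ 2).
Proof. by rewrite /eucl ler_sqrt// sumr_ge0// => k _; exact: sqr_ge0. Qed.

Context (n2 : forall j, (2 <= n j)%N).

(** Two points per class ensure that no leave-one-out minimum is taken over an empty set. *)
Lemma class_has_other (p : tidx n) (k : 'I_J) :
  exists2 p' : tidx n, tag p' = k & p' != p.
Proof.
pose c0 : tidx n := Tagged _ (Ordinal (ltnW (n2 k)) : 'I_(n k)).
pose c1 : tidx n := Tagged _ (Ordinal (n2 k) : 'I_(n k)).
have [->|c0p] := eqVneq p c0; last by exists c0; rewrite // eq_sym.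
by exists c1 => //; rewrite eq_Tagged.
Qed.

(* With margin 2 e (J + 2) between the feature vectors of class [j] and of the
   other classes, errors at most 2 e in each of the [J] coordinates are
   harmless because J < (J + 1) ^ 2. *)
Lemma correct_of_near (d : nat) (x : tidx n -> 'I_d -> R) (z : 'I_d -> R)
    (j : 'I_J) (t : 'I_J -> 'I_J -> R) (e : R) :
  (0 < d)%N -> 0 < e ->
  (forall i, i != j -> exists k, 2 * e * (J%:R + 2) <= `|t j k - t i k|) ->
  (forall p, `|d%:R^-1 * l1dist z (x p) - t j (tag p)| < e) ->
  (forall p p', p != p' ->
    `|d%:R^-1 * l1dist (x p) (x p') - t (tag p) (tag p')| < e) ->
  ~ MDist1_misclassifies x z j.
Proof.
move=> d0 e0 sep nz nx [p [pj best]].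
have D0 : 0 < d%:R :> R by rewrite ltr0n.
(* Features are unscaled distances, so limits and tolerances are multiplied by [d] throughout. *)
have unscale (u s : R) : `|d%:R^-1 * u - s| < e -> `|u - d%:R * s| < d%:R * e.
  move=> h; rewrite (_ : u - d%:R * s = d%:R * (d%:R^-1 * u - s)).
    by rewrite normrM gtr0_norm// ltr_pM2l.
  by field; rewrite gt_eqF.
have near_test k : `|feat_test x z k - d%:R * t j k| < d%:R * e.
  apply: minl1_near; first by have [p' pk _] := class_has_other p k; exists p'.
  by move=> q <- _; exact: unscale.
have near_train q k : `|feat_train x q k - d%:R * t (tag q) k| < d%:R * e.
  apply: minl1_near => [|q' <- /= qq'].
    by have [p' pk qp'] := class_has_other q k; exists p'.
  by apply: unscale; apply: nx; rewrite eq_sym.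
have [p0 p0j _] := class_has_other p j.
have := best p0 p0j; rewrite eucl_le_sum leNgt => /negP; apply.
have [k sepk] := sep _ pj.
(* Test and class-[j] features are both within [d * e] of [d * t j], hence within [d * (2 * e)] of
   each other in each coordinate. *)
apply: (@le_lt_trans _ _ (\sum_(k < J) (d%:R * (2 * e)) ^+ 2)).
  apply: ler_sum => i _; rewrite -real_normK ?num_real// lerXn2r ?nnegrE//.
    by rewrite !mulr_ge0// ltW.
  have := near_test i; have := near_train p0 i; rewrite p0j.
  have := ler_distD (d%:R * t j i) (feat_test x z i) (feat_train x p0 i).
  by rewrite [`|_ * _ - feat_train _ _ _|]distrC; lra.
rewrite sumr_const card_ord (bigD1 k)//=.
apply: ltr_wpDr; first by apply: sumr_ge0 => i _; exact: sqr_ge0.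
(* For the wrong class the separating coordinate [k] suffices: the margin [2 * e * (J + 2)] minus
   two errors [e] leaves [2 * e * (J + 1)]. *)
apply: (@lt_le_trans _ _ ((d%:R * (2 * e * (J%:R + 1))) ^+ 2)).
  rewrite !exprMn -!mulrnAr ltr_pM2l ?exprn_gt0// -mulr_natr.
  rewrite -!mulrA ltr_pM2l// ltr_pM2l ?exprn_gt0//.
  have : 0 <= J%:R :> R by []; nra.
rewrite -[leRHS]real_normK ?num_real// lerXn2r ?nnegrE//.
  by rewrite !mulr_ge0 ?addr_ge0// ltW.
have := near_test k; have := near_train p k.
have h : d%:R * (2 * e * (J%:R + 2)) <= `|d%:R * t j k - d%:R * t (tag p) k|.
  by rewrite -mulrBr normrM gtr0_norm// ler_pM2l.
have := ler_distD (feat_test x z k) (d%:R * t j k) (d%:R * t (tag p) k).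
have := ler_distD (feat_train x p k) (feat_test x z k) (d%:R * t (tag p) k).
rewrite [`|d%:R * t j k - feat_test _ _ _|]distrC.
move: h; lra.
Qed.

(** * Measurability of the misclassification event *)

Context {dT : measure_display} {T : measurableType dT}.

Lemma measurable_minl1 (d : nat) (x : tidx n -> 'I_d -> T -> R)
    (excl : pred (tidx n)) (z : 'I_d -> T -> R) (k : 'I_J) :
  (forall p q, measurable_fun setT (x p q)) ->
  (forall q, measurable_fun setT (z q)) ->
  measurable_fun setT
    (fun w => minl1 (fun p q => x p q w) excl (fun q => z q w) k).
Proof.
move=> mx mz; apply: measurableT_comp; first exact: fine_measurable.
elim: (index_enum _) => [|p s IH].
  by under eq_fun do rewrite big_nil; exact: measurable_cst.
have [h|/negPf h] := boolP ((tag p == k) && ~~ excl p); last first.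
  by under eq_fun do rewrite big_cons h.
under eq_fun do rewrite big_cons h; apply: measurable_mine => //.
apply/measurable_EFinP; apply: measurable_sum => q.
by apply: measurableT_comp => //; exact: measurable_funB.
Qed.

(** Required by [le_measure] when the event is compared with the bad events. It is a finite union of
    finite intersections of inequalities between sums of squares. *)
Lemma measurable_misclassifies (d : nat) (x : tidx n -> 'I_d -> T -> R)
    (z : 'I_d -> T -> R) (j : 'I_J) :
  (forall p q, measurable_fun setT (x p q)) ->
  (forall q, measurable_fun setT (z q)) ->
  measurable [set w |
    MDist1_misclassifies (fun p q => x p q w) (fun q => z q w) j].
Proof.
move=> mx mz.
have mdist p : measurable_fun setT (fun w => \sum_(k < J)
    (feat_test (fun p q => x p q w) (fun q => z q w) k -
     feat_train (fun p q => x p q w) p k) ^+ 2).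
  apply: measurable_sum => k; apply: measurable_funX; apply: measurable_funB.
    exact: measurable_minl1.
  exact: (measurable_minl1 _ _ mx (mx p)).
rewrite (_ : [set w | _] = \bigcup_(p in [set p : tidx n | tag p != j])
  [set w | forall p' : tidx n, tag p' = j ->
    eucl (feat_test (fun p q => x p q w) (fun q => z q w))
         (feat_train (fun p q => x p q w) p) <=
    eucl (feat_test (fun p q => x p q w) (fun q => z q w))
         (feat_train (fun p q => x p q w) p')]); last first.
  by apply/seteqP; split => [w [p [pj h]]|w [p pj h]]; exists p.
apply: fin_bigcup_measurable => [|p _]; first exact: finite_finset.
apply: measurable_fin_forall => p'.
have [p'j|p'j] := pselect (tag p' = j); last first.
  by rewrite [X in measurable X](_ : _ = setT)//; apply/seteqP; split.
rewrite [X in measurable X](_ : _ = setT `&` [set w | \sum_(k < J)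
    (feat_test (fun p q => x p q w) (fun q => z q w) k -
     feat_train (fun p q => x p q w) p k) ^+ 2 <= \sum_(k < J)
    (feat_test (fun p q => x p q w) (fun q => z q w) k -
     feat_train (fun p q => x p q w) p' k) ^+ 2]).
  exact: measurable_fun_le.
apply/seteqP; split => w /=; first by move=> h; rewrite -eucl_le_sum h.
by rewrite -eucl_le_sum => -[].
Qed.

End Features.

(** * Limit constants, separation of their rows, and the union bound over pairs *)

Theorem theorem3 (R : realType) (dT : measure_display)
  (Omega : nat -> measurableType dT) (P : forall d, probability (Omega d) R)
  (J : nat) (n : 'I_J -> nat)
  (X : forall d, tidx n -> 'I_d -> Omega d -> R)   (* training sample X_{jl} *)
  (Z : forall d, 'I_J -> 'I_d -> Omega d -> R) :  (* test observation from F_j *)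
  (2 <= J)%N ->
  (forall j, (2 <= n j)%N) ->
  (forall d p q, measurable_fun setT (X d p q)) ->
  (forall d j q, measurable_fun setT (Z d j q)) ->
  (* all X_{jl}, l < n_j, and Z (test point of class j) have the law F_j *)
  (forall d (p p' : tidx n), tag p = tag p' -> same_law (P d) (X d p) (X d p')) ->
  (forall d (p : tidx n), same_law (P d) (Z d (tag p)) (X d p)) ->
  (* training observations mutually independent, and independent of the test one *)
  (forall d j, indep_vecs (P d)
     (fun o : option (tidx n) => match o with None => Z d j | Some p => X d p end)) ->
  (* (A1) second moments bounded uniformly over coordinates and d *)
  (forall j : 'I_J, exists C : R, forall d (p : tidx n) (q : 'I_d), tag p = j ->
     (\int[P d]_w ((X d p q w) ^+ 2)%:E <= C%:E)%E) ->
  (* (A2) for independent X ~ F_j, Y ~ F_i and U = X - Y *)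
  (forall p p' : tidx n, p != p' ->
     (fun d => (d%:R ^+ 2)^-1 *
        \sum_(r < d) \sum_(s < d | s != r)
          `| Corr (P d) (fun w => `|X d p r w - X d p' r w|)
                        (fun w => `|X d p s w - X d p' s w|) |) @ \oo --> 0) ->
  (* (A3) *)
  (forall p p' : tidx n, p != p' -> exists tau : R,
     (fun d => d%:R^-1 * \sum_(q < d) Ex (P d) (fun w => `|X d p q w - X d p' q w|))
       @ \oo --> tau) ->
  (* E_{ji} > 0 for all j <> i  (X, X' ~ F_j and Y, Y' ~ F_i independent) *)
  (forall (j i : 'I_J), j != i ->
   forall (l1 l2 : 'I_(n j)) (m1 m2 : 'I_(n i)), l1 != l2 -> m1 != m2 ->
   exists E : R, 0 < E /\
     (fun d => d%:R^-1 * \sum_(q < d)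
        (2 * Ex (P d) (fun w => `|X d (existT (fun k => 'I_(n k)) j l1) q w - X d (existT (fun k => 'I_(n k)) i m1) q w|)
           - Ex (P d) (fun w => `|X d (existT (fun k => 'I_(n k)) j l1) q w - X d (existT (fun k => 'I_(n k)) j l2) q w|)
           - Ex (P d) (fun w => `|X d (existT (fun k => 'I_(n k)) i m1) q w - X d (existT (fun k => 'I_(n k)) i m2) q w|)))
       @ \oo --> E) ->
  (* conclusion: the misclassification rate of MDist1 tends to 0 *)
  forall j : 'I_J,
    (fun d => P d [set w | MDist1_misclassifies (fun p q => X d p q w)
                             (fun q => Z d j q w) j]) @ \oo --> 0%E.
Proof.
move=> _ n2 mX mZ lawX lawZ indXZ mom corr mean sep j.
(* The test point joins the training sample as index [None], with class [j], so that all pairs are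
   treated alike. *)
pose V d (o : option (tidx n)) := match o with None => Z d j | Some p => X d p end.
pose cl (o : option (tidx n)) := if o is Some p then tag p else j.
have mV d o q : measurable_fun setT (V d o q).
  by case: o => [p|]; [exact: mX|exact: mZ].
have lawV d a b : cl a = cl b -> same_law (P d) (V d a) (V d b).
  case: a b => [p|] [p'|] //=; first exact: lawX.
    by move=> pj B mB; rewrite -pj -(lawZ d p B mB).
  by move=> ->; exact: lawZ.
pose c0 i : tidx n := Tagged _ (Ordinal (ltnW (n2 i)) : 'I_(n i)).
pose c1 i : tidx n := Tagged _ (Ordinal (n2 i) : 'I_(n i)).
have c01 i : c0 i != c1 i by rewrite eq_Tagged.
(* A representative of class [k] that differs from [c0 i] even when [i = k], so the pair is always
   independent. *)
pose r i k := if i == k then c1 k else c0 k.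
have rk i k : tag (r i k) = k by rewrite /r; case: eqP.
have c0r i k : c0 i != r i k.
  rewrite /r; have [->|ik] := eqVneq i k; first exact: c01.
  by apply: contraNneq ik => /(congr1 tag) /= ->.
pose M (p p' : tidx n) d : R :=
  d%:R^-1 * \sum_(q < d) Ex (P d) (fun w => `|X d p q w - X d p' q w|).
pose t i k : R := lim (M (c0 i) (r i k) @ \oo).
have cM i k : M (c0 i) (r i k) @ \oo --> t i k.
  by have [tau h] := mean _ _ (c0r i k); apply: cvgP h.
have MC p p' : M p p' = M p' p.
  apply/funext => d; congr (_ * _); apply: eq_bigr => q _; congr (Ex _ _).
  by apply/funext => w; rewrite distrC.
have tC i k : t i k = t k i.
  have [->//|ik] := eqVneq i k.
  by rewrite /t /r (negPf ik) eq_sym (negPf ik) MC.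
have prob_train i k e : 0 < e -> (fun d => P d [set w | e <=
    `|d%:R^-1 * l1dist (fun q => X d (c0 i) q w) (fun q => X d (r i k) q w) -
      t i k|])
    @ \oo --> 0%E.
  (* (A1) yields the variance bound [2 * C + 2 * D], uniform in the coordinate and in [d]. *)
  move=> e0; have [C hC] := mom i; have [D hD] := mom k.
  have sq d q := integral_sqr_dist_le (P := P d) (mX d (c0 i) q) (mX d (r i k) q)
    (hC d (c0 i) q erefl) (hD d (r i k) q (rk i k)).
  have F2 d q : (fun w => `|X d (c0 i) q w - X d (r i k) q w|) \in Lfun (P d) 2%:E.
    apply: Lfun2_of_sqr (sq d q); apply: measurableT_comp => //.
    exact: measurable_funB.
  have FV d q := Cov_le_sqr (F2 d q) (sq d q).
  exact: (average_cvg_in_probability F2 FV (corr _ _ (c0r i k)) (cM i k) e0).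
have mdev (c s : R) : measurable_fun setT (fun y : R => `|c * y - s|).
  apply: measurableT_comp => //; apply: measurable_funB; last exact: measurable_cst.
  by apply: measurable_funM; [exact: measurable_cst|exact: measurable_id].
(* Every pair of distinct indices has the distance law of the representative pair of its classes, so
   [prob_train] extends to the test point. *)
have prob a b e : a != b -> 0 < e -> (fun d => P d [set w | e <=
    `|d%:R^-1 * l1dist (fun q => V d a q w) (fun q => V d b q w) -
      t (cl a) (cl b)|])
    @ \oo --> 0%E.
  move=> ab e0; apply: cvg_trans (prob_train (cl a) (cl b) e e0).
  apply: near_eq_cvg; apply: nearW => d.
  have mA : measurable [set y : R | e <= `|d%:R^-1 * y - t (cl a) (cl b)|].
    rewrite -[X in measurable X]setTI.
    exact: (measurable_fun_le measurableT (measurable_cst e) (mdev _ _)).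
  have ne : Some (c0 (cl a)) != Some (r (cl a) (cl b)) by exact: c0r.
  apply: (indep_l1dist_law ne ab (mV d) (indXZ d j) _ _ mA).
    exact: lawV.
  by apply: lawV; rewrite /= rk.
(* If the rows agreed at both [j] and [i], symmetry of [t] would give [t j j = t j i = t i i], and
   the energy limit [2 * t j i - t j j - t i i] would be 0. *)
have sept i : i != j -> exists k, t j k != t i k.
  move=> ij; have ji : j != i by rewrite eq_sym.
  have [E [E0 cE]] := sep j i ji (Ordinal (ltnW (n2 j))) (Ordinal (n2 j))
    (Ordinal (ltnW (n2 i))) (Ordinal (n2 i)) isT isT.
  have cE' : (fun d => 2 * M (c0 j) (r j i) d - M (c0 j) (r j j) d -
      M (c0 i) (r i i) d) @ \oo --> 2 * t j i - t j j - t i i.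
    apply: cvgB; last exact: cM.
    by apply: cvgB; [apply: cvgM; [exact: cvg_cst|]|]; exact: cM.
  have EE : E = 2 * t j i - t j j - t i i.
    apply: (cvg_unique _ cE) => //; apply: cvg_trans cE'.
    apply: near_eq_cvg; apply: nearW => d.
    rewrite /M /r eqxx (negPf ji) eqxx sumrB sumrB -mulr_sumr.
    by rewrite !mulrBr mulrCA.
  have [tj|] := eqVneq (t j j) (t i j); last by exists j.
  have [ti|] := eqVneq (t j i) (t i i); last by exists i.
  by move: E0; rewrite EE tj -ti (tC i j) => /[!lt0r] /andP[/eqP[]]; ring.
(* The smallest nonzero difference between row [j] and any other row, capped at the default 1; [e]
   is then chosen so that [2 * e * (J + 2)] equals it. *)
pose gap := \big[Num.min/1]_(ik : 'I_J * 'I_J | t j ik.2 != t ik.1 ik.2)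
  `|t j ik.2 - t ik.1 ik.2|.
have gap0 : 0 < gap.
  by apply/bigmin_gtP; split=> // ik h; rewrite normr_gt0 subr_eq0.
have J2 : 0 < J%:R + 2 :> R by rewrite ltr_wpDl.
pose e := gap / (2 * (J%:R + 2)).
have e0 : 0 < e by rewrite divr_gt0// mulr_gt0.
have sepe i : i != j -> exists k, 2 * e * (J%:R + 2) <= `|t j k - t i k|.
  move=> /sept[k tk]; exists k; rewrite (_ : _ * _ = gap).
    by apply: (bigmin_le_cond _ (j := (i, k))).
  by rewrite /e; field; rewrite gt_eqF.
pose A (ab : option (tidx n) * option (tidx n)) d : set (Omega d) := [set w | e <=
  `|d%:R^-1 * l1dist (fun q => V d ab.1 q w) (fun q => V d ab.2 q w) -
    t (cl ab.1) (cl ab.2)|].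
have mA ab d : measurable (A ab d).
  rewrite -[X in measurable X]setTI.
  apply: (measurable_fun_le measurableT (measurable_cst e)).
  apply: (measurableT_comp (mdev _ _)); apply: measurable_sum => q.
  by apply: measurableT_comp => //; exact: measurable_funB.
(* Outside the finite union of the bad events [A], all pairwise distances are near their limits and
   [correct_of_near] excludes an error as soon as [d > 0]. *)
apply: (@squeeze_cvge _ _ _ _ (cst 0%E) _
  (fun d => P d (\big[setU/set0]_(ab | ab.1 != ab.2) A ab d))).
- near=> d; rewrite measure_ge0/=; apply: le_measure; rewrite ?inE.
  + apply: measurable_misclassifies => [p q|q]; [exact: mX|exact: mZ].
  + by apply: bigsetU_measurable => ab _; exact: mA.
  + move=> w /= err; apply: contrapT => nA.
    have near_t a b : a != b -> `|d%:R^-1 * l1dist (fun q => V d a q w)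
        (fun q => V d b q w) - t (cl a) (cl b)| < e.
      move=> ab; rewrite ltNge; apply/negP => h; apply: nA.
      rewrite -bigcup_seq_cond; exists (a, b) => //=.
      by rewrite mem_index_enum.
    apply: (correct_of_near n2 _ e0 sepe) err.
    * by near: d; exact: nbhs_infty_gt.
    * by move=> p; exact: (near_t None (Some p)).
    * by move=> p p' pp'; exact: (near_t (Some p) (Some p')).
- exact: cvg_cst.
- by apply: finite_union_cvg0 => // -[a b] ab; exact: prob.
Unshelve. all: by end_near.
Qed.
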